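(* Let $\alpha\in[0,1)$ be rational and let $G\in\mathfrak F_n$ (with respect to $\alpha$). If $U\in\Gamma_\alpha(G)$ has level $l$ and $p$ is an odd prime, then $p\nmid l$.
   Context: All graphs are finite, simple and undirected; $G$ is connected (standing assumption). For a graph $G$ on $n$ vertices, $A(G)$ is its adjacency matrix, $D(G)$ its diagonal degree matrix, $A_\alpha(G)=\alpha D(G)+(1-\alpha)A(G)$. For rational $\alpha\in[0,1)$, $c_\alpha$ is the smallest positive integer such that $c_\alpha\alpha$ and $c_\alpha(1-\alpha)$ are integers, and $A_{c_\alpha}(G)=c_\alpha A_\alpha(G)$. $\mathbf 1$ is the all-ones vector and $\tilde W_\alpha(G)=\left[\mathbf 1,\frac{A_{c_\alpha}(G)\mathbf 1}{c_\alpha},\dots,\frac{A_{c_\alpha}(G)^{n-1}\mathbf 1}{c_\alpha}\right]$ (an integral matrix). $\mathfrak F_n$ is the set of graphs $G$ on $n$ vertices such that $\frac{\det\tilde W_\alpha(G)}{2^{\lfloor n/2\rfloor}}$ is an odd square-free integer and $\tilde W_\alpha(G)$ has rank $n$ over $\mathbb F_p$ for each odd prime $p\mid c_\alpha$. $O_n(\mathbb Q)$ is the set of $n\times n$ rational orthogonal matrices and $\Gamma_\alpha(G)=\{U\in O_n(\mathbb Q): U\mathbf 1=\mathbf 1,\ U^TA_{c_\alpha}(G)U=A_{c_\alpha}(H)\text{ for some graph }H\}$. The level $l(U)$ of a rational orthogonal matrix $U$ is the smallest positive integer $k$ such that $kU$ is integral. *)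

(* Defs.v *)
From mathcomp Require Import all_boot all_order all_algebra.

Set Implicit Arguments.
Unset Strict Implicit.
Unset Printing Implicit Defensive.

Import Order.TTheory GRing.Theory Num.Theory.
Local Open Scope ring_scope.

Record sgraph (n : nat) := SGraph {
  adj :> rel 'I_n;
  adj_sym : symmetric adj;
  adj_irr : irreflexive adj
}.

(* The null graph is not connected. *)
Definition connected n (G : sgraph n) : Prop :=
  (0 < n)%N /\ forall x y : 'I_n, connect G x y.

Definition adj_mx n (G : sgraph n) : 'M[rat]_n := \matrix_(i, j) (G i j)%:R.

Definition deg_mx n (G : sgraph n) : 'M[rat]_n :=
  \matrix_(i, j) (#|[set k | G i k]|%:R *+ (i == j)).

Definition A_mx (alpha : rat) n (G : sgraph n) : 'M[rat]_n :=
  alpha *: deg_mx G + (1 - alpha) *: adj_mx G.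

Definition clears (alpha : rat) (c : nat) : bool :=
  [&& (0 < c)%N, c%:R * alpha \is a Num.int & c%:R * (1 - alpha) \is a Num.int].

Lemma natr_denq_int (x : rat) (k : nat) :
  (`|denq x| %| k)%N -> k%:R * x \is a Num.int.
Proof.
case/dvdnP=> q ->; rewrite natrM -mulrA rpredM ?natr_int //.
have -> : `|denq x|%:R = (denq x)%:~R :> rat.
  by rewrite -[in RHS](gtz0_abs (denq_gt0 x)).
by rewrite mulrC -numqE intr_int.
Qed.

Lemma clears_ex (alpha : rat) : exists c, clears alpha c.
Proof.
exists `|denq alpha|%N; rewrite /clears absz_gt0 denq_neq0 /=.
have h := natr_denq_int (dvdnn `|denq alpha|).
by rewrite h mulrBr mulr1 rpredB ?natr_int.
Qed.

Definition c_ (alpha : rat) : nat := ex_minn (clears_ex alpha).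

Definition Ac_mx (alpha : rat) n (G : sgraph n) : 'M[rat]_n :=
  (c_ alpha)%:R *: A_mx alpha G.

Definition ones n : 'cV[rat]_n := const_mx 1.

(* The first column is not divided by c_alpha. *)
Definition Wtilde (alpha : rat) n (G : sgraph n) : 'M[rat]_n :=
  \matrix_(i, j)
    if (j : nat) == 0%N then ones n i 0
    else (Ac_mx alpha G ^+ j *m ones n) i 0 / (c_ alpha)%:R.

Definition int_mx m n (M : 'M[rat]_(m, n)) : bool :=
  [forall i, forall j, M i j \is a Num.int].

Lemma Ac_mx_int (alpha : rat) n (G : sgraph n) i j :
  Ac_mx alpha G i j \is a Num.int.
Proof.
rewrite !mxE /c_; case: ex_minnP => c /and3P[_ h1 h2] _.
by rewrite mulrDr !mulrA; apply: rpredD; apply: rpredM => //; rewrite ?rpredMn ?natr_int.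
Qed.

Lemma Ac_mx_ones (alpha : rat) n (G : sgraph n) :
  Ac_mx alpha G *m ones n =
  (c_ alpha)%:R *: \col_i (#|[set k | G i k]|%:R : rat).
Proof.
rewrite /Ac_mx -scalemxAl; congr (_ *: _); apply/colP=> i.
have hD : (deg_mx G *m ones n) i 0 = #|[set k | G i k]|%:R.
  rewrite mxE (bigD1 i) //= !mxE eqxx mulr1 mulr1n big1 ?addr0 // => j ji.
  by rewrite !mxE eq_sym (negPf ji) mul0r.
have hA : (adj_mx G *m ones n) i 0 = #|[set k | G i k]|%:R.
  rewrite mxE -sum1_card natr_sum [RHS]big_mkcond; apply: eq_bigr => j _.
  by rewrite !mxE mulr1 inE; case: (G i j).
rewrite mulmxDl -!scalemxAl [LHS]mxE [X in X + _]mxE [X in _ + X]mxE hD hA.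
by rewrite -mulrDl addrC subrK mul1r mxE.
Qed.

Lemma Wtilde_int (alpha : rat) n (G : sgraph n) : int_mx (Wtilde alpha G).
Proof.
apply/forallP => i; apply/forallP => j; rewrite mxE.
case: (nat_of_ord j) => [|k] /=; first by rewrite mxE.
have c0 : (c_ alpha)%:R != 0 :> rat.
  by rewrite pnatr_eq0 -lt0n /c_; case: ex_minnP => c /and3P[].
have hk (v : 'cV[rat]_n) : (forall i, v i 0 \is a Num.int) ->
    forall i, (Ac_mx alpha G ^+ k *m v) i 0 \is a Num.int.
  elim: k => [|k IH] hv l; first by rewrite expr0 mul1mx.
  rewrite exprS -[_ * _ ^+ k]/(_ *m _) -mulmxA mxE rpred_sum // => m _.
  by rewrite rpredM ?Ac_mx_int ?IH.
rewrite exprSr -[_ ^+ k * _]/(_ *m _) -mulmxA Ac_mx_ones -scalemxAr mxE mulrC mulKf //.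
by apply: hk => l; rewrite mxE natr_int.
Qed.

(* Reduction modulo p of an integral matrix; [numq x] is x itself when x is an
   integer. *)
Definition red_mx (p : nat) m n (M : 'M[rat]_(m, n)) : 'M['F_p]_(m, n) :=
  map_mx (fun x => (numq x)%:~R) M.

Definition squarefree (m : nat) : Prop :=
  forall d : nat, (d ^ 2 %| m)%N -> d = 1%N.

Definition frakF (alpha : rat) n (G : sgraph n) : Prop :=
  (exists z : int,
     [/\ \det (Wtilde alpha G) / 2 ^+ n./2 = z%:~R,
         odd `|z| & squarefree `|z|]) /\
  (forall p : nat, prime p -> odd p -> (p %| c_ alpha)%N ->
     \rank (red_mx p (Wtilde alpha G)) = n).

Definition orthogonal_mx n (U : 'M[rat]_n) : Prop := U^T *m U = 1%:M.

(* H is not required to be connected. *)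
Definition Gamma (alpha : rat) n (G : sgraph n) (U : 'M[rat]_n) : Prop :=
  [/\ orthogonal_mx U, U *m ones n = ones n &
      exists H : sgraph n, U^T *m Ac_mx alpha G *m U = Ac_mx alpha H].

Definition clears_mx n (U : 'M[rat]_n) (k : nat) : bool :=
  (0 < k)%N && int_mx (k%:R *: U).

Lemma clears_mx_ex n (U : 'M[rat]_n) : exists k, clears_mx U k.
Proof.
exists (\prod_i \prod_j `|denq (U i j)|)%N; apply/andP; split.
  apply: prodn_gt0 => i; apply: prodn_gt0 => j.
  by rewrite absz_gt0 denq_neq0.
apply/forallP => i; apply/forallP => j; rewrite mxE natr_denq_int //.
by rewrite (bigD1 i) //= dvdn_mulr // (bigD1 j) //= dvdn_mulr.
Qed.

Definition level n (U : 'M[rat]_n) : nat := ex_minn (clears_mx_ex U).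

(* Main.v *)
Require Import Defs.
From mathcomp Require Import all_boot all_order all_algebra.

(** Put [X = l U], an integral matrix with [X^T X = l^2], [A X = X B] and
    [X 1 = l 1], and let [WA], [WB] be the Krylov matrices of [A], [B] at the
    all-ones vector, so that [X WB = l WA], hence
    [det WB * X = l * WA * adj WB], while [|det WA| = |det WB|].  Suppose [p | l].
    If [p] does not divide the determinants, then [p | X].  Otherwise [p] divides
    them exactly once, so modulo [p] the kernels of [WA], [WB] are lines and
    the adjugates are nonzero.  As [A], [B] have the same characteristic
    polynomial, both satisfy [A W = W C] with the same companion matrix [C], and the
    columns of both adjugates are eigenvectors of [C].  Since [X] intertwines [A] and
    [B] modulo [p], the two eigenvalues coincide; [C] being nonderogatory, these
    columns are all proportional, whence [WA * adj WB = 0] modulo [p] and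
    again [p | X].  This contradicts the minimality of [l]. *)

Set Implicit Arguments.
Unset Strict Implicit.
Unset Printing Implicit Defensive.

Import Order.TTheory GRing.Theory Num.Theory.
Local Open Scope ring_scope.

(** * Krylov and companion matrices *)

Definition krylov_mx {R : pzRingType} {m : nat} (A : 'M[R]_m) (e : 'cV[R]_m) : 'M[R]_m :=
  \matrix_(i, j) (A ^+ j *m e) i 0.

(** The companion matrix of a monic [q] of degree [m + 1], whose leading coefficient is not
    stored. *)
Definition shift_mx {R : nzRingType} (m : nat) (q : {poly R}) : 'M[R]_m.+1 :=
  \matrix_(i, j) if j == ord_max then - q`_i else (i == j.+1 :> nat)%:R.

(** Multiplication by [A] moves each column to the next one; for the last column, Cayley-Hamilton
    expresses [A ^+ m.+1] through lower powers. *)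
Lemma krylov_shift {R : comNzRingType} (m : nat) (A : 'M[R]_m.+1)
    (e : 'cV[R]_m.+1) :
  A *m krylov_mx A e = krylov_mx A e *m shift_mx m (char_poly A).
Proof.
apply/matrixP => i j; set q := char_poly A.
have -> : (A *m krylov_mx A e) i j = (A ^+ j.+1 *m e) i 0.
  rewrite exprS -[_ * _]/(_ *m _) -mulmxA !mxE.
  by apply: eq_bigr => k _; rewrite !mxE.
rewrite [RHS]mxE; have [->|jm] := eqVneq j ord_max.
  have szq : size q = m.+2 by rewrite size_char_poly.
  have qE : A ^+ m.+1 = - \sum_(k < m.+1) q`_k *: A ^+ k.
    have := Cayley_Hamilton A; rewrite -/q -[q in horner_mx _ q]coefK szq poly_def.
    rewrite big_ord_recr /= rmorphD rmorph_sum /= linearZ /= rmorphXn /=.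
    rewrite horner_mx_X.
    have /monicP := char_poly_monic A; rewrite lead_coefE -/q szq /= => ->.
    rewrite scale1r => /eqP; rewrite addrC addr_eq0 => /eqP ->.
    congr (- _); apply: eq_bigr => k _.
    by rewrite linearZ /= rmorphXn /= horner_mx_X.
  rewrite /= qE mulNmx mulmx_suml !mxE summxE -sumrN; apply: eq_bigr => k _.
  by rewrite -scalemxAl !mxE eqxx mulrN mulrC.
have jlt : (j.+1 < m.+1)%N.
  by rewrite ltn_neqAle ltn_ord andbT; apply: contraNneq jm => jm; apply/eqP/val_inj; case: jm.
rewrite (bigD1 (Ordinal jlt)) //= big1 ?addr0 => [|k kj].
  by rewrite !mxE (negPf jm) eqxx mulr1.
rewrite [X in _ * X]mxE (negPf jm) (_ : (_ == _ :> nat) = false) ?mulr0 //.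
by apply: contraNF kj => /eqP kj; apply/eqP/val_inj.
Qed.

(** Once the last entry is zero, row [i + 1] of the eigenvector equation reads [z_i = mu * z_(i+1)],
    so zeros propagate from the last entry up. *)
Lemma shift_mx_eigen0 {R : nzRingType} (m : nat) (q : {poly R}) (mu : R)
    (z : 'cV[R]_m.+1) :
  shift_mx m q *m z = mu *: z -> z ord_max 0 = 0 -> z = 0.
Proof.
move=> hz zm; apply/colP => i; rewrite [RHS]mxE.
have [k] := ubnP (m - i); elim: k i => // k IH i.
have [->//|im] := eqVneq i ord_max.
have ilt : (i.+1 < m.+1)%N.
  by rewrite ltn_neqAle ltn_ord andbT; apply: contraNneq im => im; apply/eqP/val_inj; case: im.
rewrite ltnS => hk; have /colP/(_ (Ordinal ilt)) := hz.
rewrite [RHS]mxE (IH (Ordinal ilt)) /= ?mulr0; last first.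
  by apply: leq_trans hk; rewrite subnS prednK // subn_gt0.
rewrite mxE (bigD1 i) //= mxE (negPf im) eqxx mul1r big1 ?addr0 // => j ji.
rewrite mxE; case: eqP => [->|_]; first by rewrite zm mulr0.
by rewrite /= eqSS [i == j :> nat]eq_sym (_ : (_ == _ :> nat) = false) ?mul0r //; apply: negPf.
Qed.

(** The difference of the two sides is an eigenvector with last entry zero. This is the
    nonderogatory property of the companion matrix. *)
Lemma shift_mx_eigen_colinear {R : comNzRingType} (m : nat) (q : {poly R}) (mu : R)
    (z w : 'cV[R]_m.+1) :
  shift_mx m q *m z = mu *: z -> shift_mx m q *m w = mu *: w ->
  z ord_max 0 *: w = w ord_max 0 *: z.
Proof.
move=> hz hw; apply/eqP; rewrite -subr_eq0; apply/eqP.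
apply: (@shift_mx_eigen0 _ _ q mu); last by rewrite !mxE mulrC subrr.
rewrite mulmxBr -!scalemxAr hz hw scalerBr !scalerA.
by rewrite ![_ * mu]mulrC.
Qed.

(** * Singular matrices with nonzero adjugate over a field *)

(** A nonzero cofactor is, up to sign, the determinant of an invertible submatrix of size [m]. *)
Lemma rank_adj_neq0 {F : fieldType} (m : nat) (W : 'M[F]_m.+1) :
  \adj W != 0 -> (m <= \rank W)%N.
Proof.
move=> adjN0; have /existsP[i /existsP[j]] : [exists i, exists j, cofactor W i j != 0].
  apply: contraNT adjN0 => /existsPn h; apply/eqP/matrixP => i j.
  by rewrite !mxE; apply/eqP; have /existsPn/(_ i) := h j; rewrite negbK.
rewrite /cofactor mulf_eq0 signr_eq0 /= -unitfE -unitmxE => /mxrank_unit rk.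
rewrite -[X in (X <= _)%N]rk.
apply: (@leq_trans (\rank (col' j W))).
  by rewrite mxrankS // row'Esub rowsub_sub.
by rewrite -mxrank_tr -[X in (_ <= X)%N]mxrank_tr tr_col' mxrankS // row'Esub rowsub_sub.
Qed.

(** The left kernel of [W] is a line, spanned by a nonzero [v] from the row space of [\adj W]. It is
    stable under [A] because [v *m A *m W = v *m W *m C = 0], so [A] acts on it by a scalar. *)
Lemma left_kernel_eigen {F : fieldType} (m : nat) (W A C : 'M[F]_m.+1) :
  \det W = 0 -> \adj W != 0 -> A *m W = W *m C ->
  exists mu : F, forall k (Y : 'M_(k, m.+1)), Y *m W = 0 -> Y *m A = mu *: Y.
Proof.
move=> detW adjN0 AW; have [v vle vN0] := rowV0Pn adjN0.
have vW : v *m W = 0.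
  by have /submxP[D ->] := vle; rewrite -mulmxA mul_adj_mx detW raddf0 mulmx0.
have ker_v k (Y : 'M_(k, m.+1)) : Y *m W = 0 -> (Y <= v)%MS.
  move=> /sub_kermxP hY; apply: (submx_trans hY).
  have /sub_kermxP vK := vW.
  have := mxrank_leqif_sup vK; rewrite rank_rV vN0 mxrank_ker.
  case=> ge1 <-; rewrite eqn_leq ge1 /= leq_subLR addn1 ltnS.
  exact: rank_adj_neq0.
have /ker_v/sub_rVP[mu vA] : v *m A *m W = 0 by rewrite -mulmxA AW mulmxA vW mul0mx.
exists mu => k Y /ker_v/submxP[D ->].
by rewrite -mulmxA vA scalemxAr.
Qed.

Lemma krylov_mul_adj_eq0 {F : fieldType} (m : nat) (A B X WA WB C : 'M[F]_m.+1) (q : {poly F}) :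
  C = shift_mx m q ->
  \det WA = 0 -> \det WB = 0 -> \adj WA != 0 -> \adj WB != 0 ->
  A *m WA = WA *m C -> B *m WB = WB *m C ->
  \adj WA *m A = C *m \adj WA -> \adj WB *m B = C *m \adj WB ->
  X^T *m WA = 0 -> X *m WB = 0 -> A *m X = X *m B -> A^T = A -> X != 0 ->
  WA *m \adj WB = 0.
Proof.
move=> CE dA dB ZA0 ZB0 AW BW ZA ZB XA XB AX symA X0.
have [a ha] := @left_kernel_eigen _ _ _ _ _ dA ZA0 AW.
have [b hb] := @left_kernel_eigen _ _ _ _ _ dB ZB0 BW.
(* The rows of [X^T] and [X] lie in the left kernels of [WA] and [WB]; with [A] symmetric this gives
   [A *m X = a *: X] and [X *m B = b *: X]. *)
have ab : a = b.
  have h : a *: X = b *: X.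
    rewrite -(hb _ _ XB) -AX; apply: trmx_inj; rewrite trmx_mul symA ha ?linearZ //.
  apply/eqP; rewrite -subr_eq0; apply: contraNT X0 => h0.
  by move/eqP: h; rewrite -subr_eq0 -scalerBl scaler_eq0 (negPf h0).
subst b.
have CA : C *m \adj WA = a *: \adj WA by rewrite -ZA ha // mul_adj_mx dA raddf0.
have CB : C *m \adj WB = a *: \adj WB by rewrite -ZB hb // mul_adj_mx dB raddf0.
have eig (Z : 'M[F]_m.+1) k : C *m Z = a *: Z -> shift_mx m q *m col k Z = a *: col k Z.
  by move=> h; rewrite -CE !colE mulmxA h scalemxAl.
have /existsP[k kN0] : [exists k, col k (\adj WA) != 0].
  apply: contraNT ZA0 => /existsPn h; apply/eqP/matrixP => i j.
  by have := h j; rewrite negbK => /eqP/colP/(_ i); rewrite !mxE.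
set z := col k _ in kN0.
have zm : z ord_max 0 != 0.
  by apply: contraNneq kN0 => /(shift_mx_eigen0 (eig _ k CA)) /eqP.
have Wz : WA *m z = 0 by rewrite /z !colE mulmxA mul_mx_adj dA raddf0 mul0mx.
(* Each column of [\adj WB] is a multiple of [z], which [WA] kills. *)
apply/matrixP => i j; have := shift_mx_eigen_colinear (eig _ k CA) (eig _ j CB).
move=> /(congr1 (mulmx WA)); rewrite -!scalemxAr Wz scaler0 => /eqP.
rewrite scaler_eq0 (negPf zm) /= => /eqP/colP/(_ i).
by rewrite !colE mulmxA -colE !mxE.
Qed.

(** * Intertwining matrices *)

(** [X] intertwines the two characteristic matrices as well; its nonzero determinant cancels in the
    polynomial domain, without inverting [X]. *)
Lemma char_poly_intertwine {R : idomainType} (n : nat) (A B X : 'M[R]_n) :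
  \det X != 0 -> A *m X = X *m B -> char_poly A = char_poly B.
Proof.
move=> dX AX; pose P := map_mx polyC X.
have dP : \det P != 0 by rewrite det_map_mx polyC_eq0.
apply/eqP; rewrite -subr_eq0 -(mulIr_eq0 _ (mulIf dP)) mulrBl subr_eq0.
rewrite -[X in _ == X]mulrC -!det_mulmx; apply/eqP; congr (\det _).
rewrite mulmxBl mulmxBr -!map_mxM AX; congr (_ - _).
by rewrite mul_scalar_mx mul_mx_scalar.
Qed.

Lemma krylov_intertwine {R : pzRingType} (m : nat) (A B X : 'M[R]_m.+1)
    (e : 'cV[R]_m.+1) :
  A *m X = X *m B -> X *m krylov_mx B e = krylov_mx A (X *m e).
Proof.
move=> AX; apply/matrixP => i j.
have -> : krylov_mx A (X *m e) i j = (X *m (B ^+ j *m e)) i 0.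
  rewrite mxE !mulmxA; congr ((_ *m _) i 0).
  elim: (nat_of_ord j) => [|k IH]; first by rewrite !expr0 mul1mx mulmx1.
  by rewrite !exprSr -[_ * A]/(_ *m A) -mulmxA AX mulmxA IH -mulmxA.
by rewrite !mxE; apply: eq_bigr => k _; rewrite !mxE.
Qed.

Lemma map_krylov {R S : pzRingType} (f : {rmorphism R -> S}) (m : nat)
    (A : 'M[R]_m.+1) (e : 'cV[R]_m.+1) :
  map_mx f (krylov_mx A e) = krylov_mx (map_mx f A) (map_mx f e).
Proof.
apply/matrixP => i j; rewrite [LHS]mxE [krylov_mx A e i j]mxE [RHS]mxE.
by rewrite -rmorphXn /= -map_mxM [RHS]mxE.
Qed.

(** [\det X] squares to [l ^ (2 n)], so the two determinants have equal squares. *)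
Lemma abs_det_orthogonal_mul (n l : nat) (X WA WB : 'M[int]_n) :
  (0 < l)%N -> X^T *m X = (l%:Z ^+ 2)%:M -> X *m WB = l%:Z *: WA ->
  `|\det WA|%N = `|\det WB|%N.
Proof.
move=> l0 XX XW; have lN0 : l%:Z != 0 by rewrite -lt0n.
have dX : \det X ^+ 2 = (l%:Z ^+ n) ^+ 2.
  by rewrite -[RHS]exprM mulnC exprM -[RHS]det_scalar -XX det_mulmx det_tr.
have := congr1 determinant XW; rewrite det_mulmx detZ => /(congr1 (fun x => x ^+ 2)).
rewrite !exprMn dX => /mulfI h; apply/eqP; rewrite -eqz_nat; apply/eqP.
have /eqP : \det WB ^+ 2 = \det WA ^+ 2.
  by apply: h; rewrite !expf_neq0.
by rewrite eqf_sqr => /orP[] /eqP ->; rewrite ?abszN.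
Qed.

(** * Reduction modulo [p] and divisibility of the intertwiner *)

Lemma intr_Fp_eq0 (p : nat) (x : int) :
  prime p -> (x%:~R == 0 :> 'F_p) = (p%:Z %| x)%Z.
Proof. by move=> pp; rewrite (dvdz_pcharf (pchar_Fp pp)). Qed.

Lemma map_intr_Fp_eq0 (p m n : nat) (M : 'M[int]_(m, n)) :
  prime p ->
  map_mx (intr : int -> 'F_p) M = 0 <-> forall i j, (p%:Z %| M i j)%Z.
Proof.
move=> pp; split=> [/matrixP h i j|h].
  by have := h i j; rewrite !mxE => /eqP; rewrite intr_Fp_eq0.
by apply/matrixP => i j; rewrite !mxE; apply/eqP; rewrite intr_Fp_eq0.
Qed.

(* If [\adj W] vanished modulo [p], then [p ^ (m + 1)] would divide
   [\det (\adj W) = \det W ^ m]. *)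
Lemma adj_Fp_neq0 (p m : nat) (W : 'M[int]_m.+1) :
  prime p -> ~~ (p%:Z ^+ 2 %| \det W)%Z ->
  \adj (map_mx (intr : int -> 'F_p) W) != 0.
Proof.
move=> pp p2; rewrite -map_mx_adj; apply/negP => /eqP/map_intr_Fp_eq0 => /(_ pp) h.
have d0 : \det W != 0 by apply: contraNneq p2 => ->; rewrite dvdz0.
have dadj : \det (\adj W) = \det W ^+ m.
  by apply: (mulIf d0); rewrite -det_mulmx mul_adj_mx det_scalar exprSr.
have adjE : \adj W = p%:Z *: map_mx (fun x => (x %/ p%:Z)%Z) (\adj W).
  by apply/matrixP => i j; rewrite [RHS]mxE [X in _ * X]mxE mulrC divzK.
have : (p%:Z ^+ m.+1 %| \det W ^+ m)%Z by rewrite -dadj adjE detZ dvdz_mulr.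
move: p2; rewrite !dvdzE !abszX !absz_nat !pfactor_dvdn ?expn_gt0 ?absz_gt0 ?d0 //.
rewrite -leqNgt lognX => le1; apply/negP; rewrite -leqNgt.
by rewrite -[X in (_ <= X)%N]muln1 leq_mul2l le1 orbT.
Qed.

Lemma scalemx_inj {R : idomainType} (m n : nat) (a : R) :
  a != 0 -> injective ( *:%R a : 'M[R]_(m, n) -> 'M[R]_(m, n)).
Proof.
move=> a0 P Q /matrixP h; apply/matrixP => i j; apply: (mulfI a0).
by have := h i j; rewrite !mxE.
Qed.

Lemma mul_intertwine_adj (n l : nat) (X WA WB : 'M[int]_n) i j :
  X *m WB = l%:Z *: WA ->
  \det WB * X i j = l%:Z * (WA *m \adj WB) i j.
Proof.
move=> XW; have /matrixP/(_ i j) : \det WB *: X = l%:Z *: (WA *m \adj WB).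
  by rewrite scalemxAl -XW -mulmxA mul_mx_adj mul_mx_scalar.
by rewrite [LHS]mxE [RHS]mxE.
Qed.

Lemma dvd_intertwiner_ndvd_det (p n l : nat) (X WA WB : 'M[int]_n) i j :
  prime p -> (p %| l)%N -> X *m WB = l%:Z *: WA ->
  ~~ (p%:Z %| \det WB)%Z -> (p%:Z %| X i j)%Z.
Proof.
move=> pp pl XW; have h := mul_intertwine_adj i j XW.
rewrite dvdzE -prime_coprime // => cop.
have : (p%:Z %| \det WB * X i j)%Z by rewrite h dvdz_mulr.
by rewrite Gauss_dvdzr.
Qed.

(** Multiplied by [\det W], both sides become [\adj W *m M *m W *m \adj W]. Proved over the
    integers, the identity survives reduction modulo [p], where the determinant may vanish. *)
Lemma mul_adj_commute {R : idomainType} (n : nat) (M W C : 'M[R]_n) :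
  \det W != 0 -> M *m W = W *m C -> \adj W *m M = C *m \adj W.
Proof.
move=> dW MW; apply: (scalemx_inj dW).
have : \adj W *m M *m (W *m \adj W) = \adj W *m W *m (C *m \adj W).
  by rewrite !mulmxA -[\adj W *m M *m W]mulmxA MW !mulmxA.
by rewrite mul_mx_adj mul_adj_mx mul_mx_scalar mul_scalar_mx.
Qed.

Lemma map_shift_mx {R S : nzRingType} (f : {rmorphism R -> S}) (m : nat) (q : {poly R}) :
  map_mx f (shift_mx m q) = shift_mx m (map_poly f q).
Proof.
apply/matrixP => i j; rewrite !mxE; case: (j == ord_max).
  by rewrite rmorphN coef_map.
by rewrite rmorph_nat.
Qed.

Lemma det_map_intr_Fp_eq0 (p n : nat) (W : 'M[int]_n) :
  prime p -> (p%:Z %| \det W)%Z -> \det (map_mx (intr : int -> 'F_p) W) = 0.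
Proof. by move=> pp pd; rewrite det_map_mx; apply/eqP; rewrite intr_Fp_eq0. Qed.

Lemma map_scale_Fp_eq0 (p l m n : nat) (P : 'M[int]_(m, n)) :
  prime p -> (p %| l)%N -> map_mx (intr : int -> 'F_p) (l%:Z *: P) = 0.
Proof.
by move=> pp pl; apply/(map_intr_Fp_eq0 _ pp) => r s; rewrite mxE dvdz_mulr.
Qed.

Lemma mul_adj_Fp_eq0 (p m l : nat) (A B X WA WB : 'M[int]_m.+1) (q : {poly int}) :
  prime p -> (p %| l)%N -> A^T = A -> A *m X = X *m B ->
  X *m WB = l%:Z *: WA -> X^T *m WA = l%:Z *: WB ->
  A *m WA = WA *m shift_mx m q -> B *m WB = WB *m shift_mx m q ->
  (p%:Z %| \det WA)%Z -> ~~ (p%:Z ^+ 2 %| \det WA)%Z ->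
  (p%:Z %| \det WB)%Z -> ~~ (p%:Z ^+ 2 %| \det WB)%Z ->
  map_mx (intr : int -> 'F_p) X != 0 ->
  map_mx (intr : int -> 'F_p) (WA *m \adj WB) = 0.
Proof.
move=> pp pl symA AX XW XTW AW BW pA p2A pB p2B X0.
have dA : \det WA != 0 by apply: contraNneq p2A => ->; rewrite dvdz0.
have dB : \det WB != 0 by apply: contraNneq p2B => ->; rewrite dvdz0.
have ZA := mul_adj_commute dA AW; have ZB := mul_adj_commute dB BW.
have redM (P Q : 'M[int]_m.+1) : map_mx (intr : int -> 'F_p) (P *m Q) =
    map_mx intr P *m map_mx intr Q by exact: map_mxM.
rewrite redM map_mx_adj.
apply: (krylov_mul_adj_eq0 (A := map_mx intr A) (B := map_mx intr B) (map_shift_mx _ m q)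
  (det_map_intr_Fp_eq0 pp pA) (det_map_intr_Fp_eq0 pp pB)
  (adj_Fp_neq0 pp p2A) (adj_Fp_neq0 pp p2B) _ _ _ _ _ _ _ _ X0).
- by rewrite -redM AW redM.
- by rewrite -redM BW redM.
- by rewrite -map_mx_adj -redM ZA redM.
- by rewrite -map_mx_adj -redM ZB redM.
- by rewrite map_trmx -redM XTW map_scale_Fp_eq0.
- by rewrite -redM XW map_scale_Fp_eq0.
- by rewrite -redM AX redM.
- by rewrite map_trmx symA.
Qed.

Lemma dvd_intertwiner_simple_det (p m l : nat) (A B X : 'M[int]_m.+1)
    (e : 'cV[int]_m.+1) i j :
  prime p -> (0 < l)%N -> (p %| l)%N -> A^T = A ->
  X^T *m X = (l%:Z ^+ 2)%:M -> A *m X = X *m B -> X *m e = l%:Z *: e ->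
  (p%:Z %| \det (krylov_mx A e))%Z -> ~~ (p%:Z ^+ 2 %| \det (krylov_mx A e))%Z ->
  (p%:Z %| X i j)%Z.
Proof.
move=> pp l0 pl symA XX AX Xe.
have lN0 : l%:Z != 0 by rewrite -lt0n.
have XW : X *m krylov_mx B e = l%:Z *: krylov_mx A e.
  rewrite (krylov_intertwine e AX) Xe; apply/matrixP => r s.
  by rewrite [LHS]mxE -scalemxAr [LHS]mxE [RHS]mxE [krylov_mx A e r s]mxE.
have dX : \det X != 0.
  apply: contraNneq (expf_neq0 (2 * m.+1) lN0) => dX.
  by rewrite exprM -det_scalar -XX det_mulmx dX mulr0.
have AW := krylov_shift A e.
(* Equal characteristic polynomials give both Krylov matrices the same companion matrix. *)
have := krylov_shift B e; rewrite -(char_poly_intertwine dX AX).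
move: (krylov_mx A e) (krylov_mx B e) XW AW => WA WB XW AW BW pd p2.
have XTW : X^T *m WA = l%:Z *: WB.
  apply: (scalemx_inj lN0).
  have -> : l%:Z *: (X^T *m WA) = X^T *m X *m WB by rewrite -mulmxA XW scalemxAr.
  by rewrite XX mul_scalar_mx scalerA.
have absd := abs_det_orthogonal_mul l0 XX XW.
have pdB : (p%:Z %| \det WB)%Z by move: pd; rewrite !dvdzE absd.
have p2B : ~~ (p%:Z ^+ 2 %| \det WB)%Z by move: p2; rewrite !dvdzE absd.
have [X0|XN0] := eqVneq (map_mx (intr : int -> 'F_p) X) 0.
  by have /(map_intr_Fp_eq0 _ pp) := X0.
have /(map_intr_Fp_eq0 _ pp)/(_ i j) dWZ :=
  mul_adj_Fp_eq0 pp pl symA AX XW XTW AW BW pd p2 pdB p2B XN0.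
(* One factor [p] comes from [l], the other from [WA *m \adj WB] vanishing modulo [p]; [\det WB] can
   absorb only one of them. *)
have p2X : (p%:Z ^+ 2 %| \det WB * X i j)%Z.
  by rewrite (mul_intertwine_adj _ _ XW) dvdz_mul.
apply: contraNT p2B => pX; rewrite -(Gauss_dvdzl _ (p := X i j)) //.
by apply: coprimezXl; rewrite coprimezE /= prime_coprime -?dvdzE.
Qed.

(** * Integral lifts and the level *)

Lemma level_gt0 n (U : 'M[rat]_n) : (0 < level U)%N.
Proof. by rewrite /level; case: ex_minnP => k /andP[]. Qed.

Lemma level_int n (U : 'M[rat]_n) : int_mx ((level U)%:R *: U).
Proof. by rewrite /level; case: ex_minnP => k /andP[]. Qed.

Lemma int_mx_lift m n (M : 'M[rat]_(m, n)) :
  int_mx M -> exists P : 'M[int]_(m, n), map_mx intr P = M.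
Proof.
move=> /forallP h; exists (map_mx (fun x => numq x) M).
apply/matrixP => i j; rewrite !mxE numqK //.
by have /forallP := h i; apply.
Qed.

Lemma map_mx_intr_inj m n : injective (map_mx intr : 'M[int]_(m, n) -> 'M[rat]_(m, n)).
Proof.
by move=> P Q /matrixP h; apply/matrixP => r s; have := h r s; rewrite !mxE => /intr_inj.
Qed.

(** Otherwise [level U] divided by [p] would already clear the denominators of [U], against
    minimality. *)
Lemma level_primitive n (U : 'M[rat]_n) (X : 'M[int]_n) (p : nat) :
  prime p -> (p %| level U)%N -> map_mx intr X = (level U)%:R *: U ->
  ~ (forall i j, (p%:Z %| X i j)%Z).
Proof.
move=> pp /dvdnP[k kE] XE h.
have k0 : (0 < k)%N by have := level_gt0 U; rewrite kE muln_gt0 => /andP[].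
have : (level U <= k)%N.
  rewrite {1}/level; case: ex_minnP => ? _; apply; rewrite /clears_mx k0.
  apply/forallP => i; apply/forallP => j; have /dvdzP[q qE] := h i j.
  suff -> : (k%:R *: U) i j = q%:~R by apply/intrP; exists q.
  have p0 : p%:R != 0 :> rat by rewrite pnatr_eq0 -lt0n prime_gt0.
  apply: (mulfI p0); rewrite mxE mulrA -natrM mulnC -kE.
  have /matrixP/(_ i j) := XE.
  by rewrite [LHS]mxE qE [RHS]mxE => <-; rewrite rmorphM mulrC.
by rewrite kE leqNgt ltn_Pmulr // prime_gt1.
Qed.

(** * The walk matrix as a rescaled Krylov matrix *)

Lemma c_gt0 (alpha : rat) : (0 < c_ alpha)%N.
Proof. by rewrite /c_; case: ex_minnP => c /and3P[]. Qed.

Lemma Ac_mx_sym (alpha : rat) n (G : sgraph n) : (Ac_mx alpha G)^T = Ac_mx alpha G.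
Proof.
apply/matrixP => i j; rewrite !mxE adj_sym.
by have [->|ij] := eqVneq i j; rewrite // mulr0n eq_sym (negPf ij).
Qed.

Definition Wtilde_scale (alpha : rat) (n : nat) : 'rV[rat]_n :=
  \row_j if (j : nat) == 0%N then 1 else (c_ alpha)%:R^-1.

Lemma WtildeE (alpha : rat) (m : nat) (G : sgraph m.+1) :
  Wtilde alpha G =
  krylov_mx (Ac_mx alpha G) (ones m.+1) *m diag_mx (Wtilde_scale alpha m.+1).
Proof.
rewrite mul_mx_diag; apply/matrixP => i j.
rewrite [LHS]mxE [RHS]mxE [krylov_mx _ _ i j]mxE [Wtilde_scale _ _ 0 j]mxE.
by case: eqP => [->|//]; rewrite expr0 mul1mx mulr1.
Qed.

(** The exponent is [m], not [m + 1], because the first column is not divided by [c_ alpha]. *)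
Lemma det_Wtilde (alpha : rat) (m : nat) (G : sgraph m.+1) :
  \det (krylov_mx (Ac_mx alpha G) (ones m.+1)) =
  (c_ alpha)%:R ^+ m * \det (Wtilde alpha G).
Proof.
have c0 : (c_ alpha)%:R != 0 :> rat by rewrite pnatr_eq0 -lt0n c_gt0.
rewrite WtildeE det_mulmx det_diag big_ord_recl !mxE /= mul1r.
rewrite (eq_bigr (fun=> (c_ alpha)%:R^-1)) => [|k _]; last by rewrite mxE.
by rewrite prodr_const card_ord mulrCA -exprMn divff ?expr1n ?mulr1.
Qed.

Lemma dvdz_pfactor_half (p k : nat) (z : int) (s : nat) : 
  prime p -> odd p -> (p%:Z ^+ s %| z * 2 ^+ k)%Z -> (p%:Z ^+ s %| z)%Z.
Proof.
move=> pp op; rewrite mulrC Gauss_dvdzr //.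
apply/coprimezXl/coprimezXr; rewrite coprimezE /= prime_coprime //.
by rewrite dvdn_prime2 //; apply: contraL op => /eqP ->.
Qed.

Theorem theorem3p1 (alpha : rat) (n : nat) (G : sgraph n) (U : 'M[rat]_n)
    (l p : nat) :
  0 <= alpha < 1 ->
  connected G ->
  frakF alpha G ->
  Gamma alpha G U ->
  level U = l ->
  prime p -> odd p ->
  ~~ (p %| l)%N.
Proof.
move=> _ [n0 _] [[z [detz _ sqfz]] rkW] [orthU Uones [H UAU]] <- pp op.
(* Connectedness provides [0 < n], so the size can be written [m + 1]. *)
case: n n0 => // m _ in G U detz rkW orthU Uones H UAU *.
apply/negP => pl; have [X XE] := int_mx_lift (level_int U).
apply: (level_primitive pp pl XE) => i j.
move: (level U) (level_gt0 U) pl XE => l0 l0_gt0 pl XE.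
have intA (K : sgraph m.+1) : int_mx (Ac_mx alpha K).
  by apply/forallP => a; apply/forallP => b; exact: Ac_mx_int.
have [A AE] := int_mx_lift (intA G).
have [B BE] := int_mx_lift (intA H).
have [WG WGE] := int_mx_lift (Wtilde_int alpha G).
have [WH WHE] := int_mx_lift (Wtilde_int alpha H).
have AU : Ac_mx alpha G *m U = U *m Ac_mx alpha H.
  by rewrite -UAU !mulmxA (mulmx1C orthU) mul1mx.
have UW : U *m Wtilde alpha H = Wtilde alpha G.
  by rewrite !WtildeE mulmxA (krylov_intertwine _ AU) Uones.
have XX : X^T *m X = (l0%:Z ^+ 2)%:M.
  apply: map_mx_intr_inj; rewrite map_mxM -map_trmx XE [(_ *: _)^T]linearZ /=.
  rewrite -scalemxAl -scalemxAr.
  by rewrite orthU scalerA scalemx1 map_scalar_mx /= rmorphXn.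
have XW : X *m WH = l0%:Z *: WG.
  by apply: map_mx_intr_inj; rewrite map_mxM map_mxZ XE WGE WHE -scalemxAl UW.
have detW : \det WG = z * 2 ^+ (m.+1)./2.
  apply: (@intr_inj rat); rewrite -det_map_mx WGE rmorphM /= -detz rmorphXn /=.
  by rewrite divfK // expf_neq0.
have [pd|pd] := boolP (p%:Z %| \det WG)%Z; last first.
  apply: (dvd_intertwiner_ndvd_det _ _ pp pl XW).
  by rewrite dvdzE -(abs_det_orthogonal_mul l0_gt0 XX XW).
(* If [p] divided [c_ alpha], the rank condition would make [WG] invertible modulo [p], against
   [pd]. *)
have pc : ~~ (p %| c_ alpha)%N.
  apply/negP => /(rkW p pp op) rk; have : red_mx p (Wtilde alpha G) \in unitmx.
    by rewrite -row_full_unit /row_full rk.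
  have -> : red_mx p (Wtilde alpha G) = map_mx (intr : int -> 'F_p) WG.
    by rewrite -WGE; apply/matrixP => a b; rewrite !mxE numq_int.
  by rewrite unitmxE unitfE det_map_intr_Fp_eq0 ?eqxx.
(* As [p] is odd, the power of 2 is harmless and [p ^ 2] would divide the square-free [z]. *)
have p2 : ~~ (p%:Z ^+ 2 %| \det WG)%Z.
  rewrite detW; apply/negP => /(dvdz_pfactor_half pp op).
  by rewrite dvdzE abszX => /sqfz; rewrite absz_nat => p1; rewrite p1 in pp.
(* Since [p] does not divide [c_ alpha], passing to the Krylov matrix preserves the exact power of
   [p] in the determinant. *)
have detK : \det (krylov_mx A (const_mx 1)) = (c_ alpha)%:Z ^+ m * \det WG.
  apply: (@intr_inj rat); rewrite -det_map_mx map_krylov AE map_const_mx.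
  by rewrite rmorphM rmorphXn /= -det_map_mx WGE -det_Wtilde.
apply: (@dvd_intertwiner_simple_det p m l0 A B X (const_mx 1)) => //.
- by apply: map_mx_intr_inj; rewrite -map_trmx AE Ac_mx_sym.
- by apply: map_mx_intr_inj; rewrite !map_mxM XE AE BE -scalemxAr AU scalemxAl.
- by apply: map_mx_intr_inj; rewrite map_mxM map_mxZ XE map_const_mx -scalemxAl Uones.
- by rewrite detK dvdz_mull.
- rewrite detK Gauss_dvdzr //; apply/coprimezXl/coprimezXr.
  by rewrite coprimezE prime_coprime.
Qed.
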